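(* Let $(\mathcal{P},\omega)$ be an oriented partition of the connected graph $G$ into $t$ classes, with signed cycle–class matrix $A\in\mathbb{Z}^{c\times t}$. Then: (i) The most generic consistent generator assignment takes values in the finitely generated abelian group $\Gamma_{\mathrm{univ}}=\mathbb{Z}^t/\mathrm{rowlattice}(A)$, with $g_j$ the image of the $j$-th standard basis vector; every consistent assignment in any abelian group is a homomorphic image of it. (ii) The Smith Normal Form computes it: if $UA^{\top}W=\mathrm{diag}(d_1,\dots,d_\rho,0,\dots)$ with $U,W$ unimodular, then $\Gamma_{\mathrm{univ}}\cong\mathbb{Z}_{d_1}\times\cdots\times\mathbb{Z}_{d_\rho}\times\mathbb{Z}^{t-\rho}$ (factors with $d_i=1$ trivial), and the coordinates of $g_j$ are read off the $j$-th column of $U$, reduced modulo $d_i$ in the torsion coordinates. (iii) Let $\phi$ be the labeling of $V(G)$ induced by this assignment. With $S=\{\pm g_j: g_j\neq0\}$, every path of length $\ell$ in $G$ maps under $\phi$ to a walk of length $\ell$ in the Cayley graph $\mathrm{Cay}(\Gamma_{\mathrm{univ}},S)$, hence $d_{\mathrm{Cay}}(\phi(u),\phi(v))\leq d_G(u,v)$ for all pairs $u,v$: the only possible failure of isometry is a shortcut (a pair with $d_{\mathrm{Cay}}(\phi(u),\phi(v))<d_G(u,v)$).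
   Context: Graphs are finite, simple, connected and undirected; $d_G$ is the shortest-path distance. An oriented partition of $G$ is a partition $\mathcal{P}=\{F_1,\dots,F_t\}$ of $E(G)$ together with a chosen (forward) direction, recorded by $\omega$, of every edge; $\mathrm{class}(e)=j$ means $e\in F_j$. An assignment $g_1,\dots,g_t$ of elements of an abelian group to the classes is consistent if for every cycle of $G$, traversed in a fixed rotational sense, the sum of $\pm g_{\mathrm{class}(e)}$ over its edges ($+$ if traversed forward, $-$ if backward) is $0$. A consistent assignment $(g'_1,\dots,g'_t)$ in an abelian group $\Gamma$ is a homomorphic image of $(g_1,\dots,g_t)$ in $\Gamma_{\mathrm{univ}}$ if there is a homomorphism $\Gamma_{\mathrm{univ}}\to\Gamma$ with $g_j\mapsto g'_j$ for all $j$. The labeling induced by an assignment is $\phi(v)=\sum_{e\in P(r,v)}\pm g_{\mathrm{class}(e)}$, summed along a path $P(r,v)$ from a root $r$ to $v$ with the same sign rule. For a cycle basis $B_1,\dots,B_c$ of $G$ (each cycle traversed in a fixed sense), $A[i,j]$ is the net signed number of crossings of $F_j$ by $B_i$ (forward traversals $+1$, backward $-1$). $\mathrm{rowlattice}(A)$ is the subgroup of $\mathbb{Z}^t$ generated by the rows of $A$; $\rho=\mathrm{rank}(A)$. $\mathrm{Cay}(\Gamma,S)$ is the graph on $\Gamma$ with edges $\{g,g+s\}$, $s\in S$; $d_{\mathrm{Cay}}$ is its shortest-path distance.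
   Formalization: The cycle basis is taken to be an integral one (a Z-basis of the cycle lattice); in (iii) a path maps to a walk of the same length whose steps are Cayley edges or stationary, and to a genuine walk in Cay when all its edges lie in classes with g_j nonzero. *)

(* Defs.v *)
From HB Require Import structures.
From mathcomp Require Import all_boot all_order all_algebra.
From mathcomp Require Import boolp.

Set Implicit Arguments.
Unset Strict Implicit.
Unset Printing Implicit Defensive.

Import GRing.Theory.
Local Open Scope ring_scope.

(** * Graphs and cycles *)

Record cgraph (T : finType) := CGraph {
  adj : rel T;
  adj_sym : symmetric adj;
  adj_irr : irreflexive adj;
  adj_connected : forall x y, connect adj x y }.

Definition edges (T : finType) (G : cgraph T) : {set {set T}} :=
  [set [set u.1; u.2] | u : T * T & adj G u.1 u.2].

Definition is_path (T : finType) (G : cgraph T) (x : T) (p : seq T) : bool :=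
  path (adj G) x p && uniq (x :: p).

(* The sequence c also fixes the rotational sense: the successor of x on the
   cycle is next c x, and the reversed cycle is rev c. *)
Definition is_cycle (T : finType) (G : cgraph T) (c : seq T) : Prop :=
  ucycle (adj G) c /\ (2 < size c)%N.

(* The element of the integral cycle space H_1(G; Z) carried by a cycle, as an
   antisymmetric function on ordered pairs of vertices. *)
Definition cycle_flow (T : finType) (c : seq T) : {ffun T * T -> int} :=
  [ffun u => \sum_(x <- c) ((((x, next c x) == u)%:R : int)
                            - ((next c x, x) == u)%:R)].

(* Integral cycle basis: cycles forming a Z-basis of H_1(G; Z), which is spanned
   by the cycles of G (fundamental cycles of a spanning tree, for instance).
   A basis over a field is not enough for the rows of the cycle-class matrix to
   account for all the cycles. *)
Definition is_cycle_basis (T : finType) (G : cgraph T) (c : nat)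
    (B : 'I_c -> seq T) : Prop :=
  [/\ forall i, is_cycle G (B i),
      forall k : 'I_c -> int,
        \sum_i cycle_flow (B i) *~ k i = 0 -> forall i, k i = 0
    & forall z, is_cycle G z ->
        exists k : 'I_c -> int, cycle_flow z = \sum_i cycle_flow (B i) *~ k i].

(** * Oriented partitions and assignments *)

(* Injectivity of part makes t the number of classes, and finset's partition
   requires the classes to be nonempty. *)
Record oriented_partition (T : finType) (G : cgraph T) (t : nat) :=
  OrientedPartition {
    part : 'I_t -> {set {set T}};
    part_inj : injective part;
    part_partition : partition [set part j | j : 'I_t] (edges G);
    fwd : rel T;
    fwd_orient : forall x y, adj G x y -> fwd y x = ~~ fwd x y }.

(* The signed contribution of the step from x to y. The sum has exactly one
   term when xy is an edge, for j the class of that edge. *)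
Definition step (T : finType) (G : cgraph T) (t : nat)
    (P : oriented_partition G t) (M : zmodType) (g : 'I_t -> M) (x y : T) : M :=
  \sum_(j | [set x; y] \in part P j) (if fwd P x y then g j else - g j).

Definition cycle_sum (T : finType) (G : cgraph T) (t : nat)
    (P : oriented_partition G t) (M : zmodType) (g : 'I_t -> M) (c : seq T) : M :=
  \sum_(x <- c) step P g x (next c x).

Definition consistent (T : finType) (G : cgraph T) (t : nat)
    (P : oriented_partition G t) (M : zmodType) (g : 'I_t -> M) : Prop :=
  forall c, is_cycle G c -> cycle_sum P g c = 0.

Fixpoint path_sum (T : finType) (G : cgraph T) (t : nat)
    (P : oriented_partition G t) (M : zmodType) (g : 'I_t -> M)
    (x : T) (p : seq T) : M :=
  if p is y :: p' then step P g x y + path_sum P g y p' else 0.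

(* phi is the labeling with root r obtained by choosing, for each vertex v, some
   path from r to v. *)
Definition induced_labeling (T : finType) (G : cgraph T) (t : nat)
    (P : oriented_partition G t) (M : zmodType) (g : 'I_t -> M)
    (r : T) (phi : T -> M) : Prop :=
  forall v, exists p, [/\ is_path G r p, last r p = v & phi v = path_sum P g r p].

(** * The universal group *)

Definition cycle_class_matrix (T : finType) (G : cgraph T) (t : nat)
    (P : oriented_partition G t) (c : nat) (B : 'I_c -> seq T) : 'M[int]_(c, t) :=
  \matrix_(i, j) \sum_(x <- B i | [set x; next (B i) x] \in part P j)
                    (if fwd P x (next (B i) x) then 1 else -1).

Definition rowlattice (c t : nat) (A : 'M[int]_(c, t)) : {pred 'rV[int]_t} :=
  fun v => `[< exists u : 'rV[int]_c, v = u *m A >].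

Lemma rowlattice_zmod_closed c t (A : 'M[int]_(c, t)) : zmod_closed (rowlattice A).
Proof.
split=> [|v w /asboolP[a ->] /asboolP[b ->]]; apply/asboolP.
  by exists 0; rewrite mul0mx.
by exists (a - b); rewrite mulmxBl.
Qed.

HB.instance Definition _ c t (A : 'M[int]_(c, t)) :=
  GRing.isZmodClosed.Build 'rV[int]_t (rowlattice A) (rowlattice_zmod_closed A).

Definition Gamma_univ (c t : nat) (A : 'M[int]_(c, t)) : zmodType :=
  Quotient.quot (rowlattice A).

Definition gen_univ (c t : nat) (A : 'M[int]_(c, t)) (j : 'I_t) : Gamma_univ A :=
  (\pi_(Quotient.quot (rowlattice A)) (delta_mx 0 j))%qT.

Definition finitely_generated (M : zmodType) : Prop :=
  exists (n : nat) (g : 'I_n -> M),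
    forall x : M, exists k : 'I_n -> int, x = \sum_i g i *~ k i.

(** * Products of cyclic groups *)

Section DffunZmod.
Variables (I : finType) (M : I -> zmodType).
Implicit Types f g h : {dffun forall i, M i}.

Definition dffun_zero : {dffun forall i, M i} := [ffun i => 0 : M i].
Definition dffun_opp f : {dffun forall i, M i} := [ffun i => - f i].
Definition dffun_add f g : {dffun forall i, M i} := [ffun i => f i + g i].

Lemma dffun_addA : associative dffun_add.
Proof. by move=> f g h; apply/ffunP=> i; rewrite !ffunE addrA. Qed.
Lemma dffun_addC : commutative dffun_add.
Proof. by move=> f g; apply/ffunP=> i; rewrite !ffunE addrC. Qed.
Lemma dffun_add0 : left_id dffun_zero dffun_add.
Proof. by move=> f; apply/ffunP=> i; rewrite !ffunE add0r. Qed.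
Lemma dffun_addN : left_inverse dffun_zero dffun_opp dffun_add.
Proof. by move=> f; apply/ffunP=> i; rewrite !ffunE addNr. Qed.

HB.instance Definition _ := GRing.isZmodule.Build {dffun forall i, M i}
  dffun_addA dffun_addC dffun_add0 dffun_addN.
End DffunZmod.

(* Z/dZ for any integer d; unlike 'Z_d, it is trivial when d = 1. *)
Definition Zmod (d : int) : zmodType := Quotient.quot (dvdz d : {pred int}).

Definition to_Zmod (d k : int) : Zmod d := (\pi_(Quotient.quot (dvdz d : {pred int})) k)%qT.

Definition Zmod_prod (d : seq int) : zmodType :=
  {dffun forall i : 'I_(size d), Zmod d`_i}.

Definition diag_of_seq (m n : nat) (d : seq int) : 'M[int]_(m, n) :=
  \matrix_(i, j) (d`_i *+ (i == j :> nat)).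

Definition int_rank (m n : nat) (A : 'M[int]_(m, n)) : nat :=
  \rank (map_mx (intr : int -> rat) A).

(** * Cayley graphs and distances *)

Definition signed_gens (M : zmodType) (t : nat) (g : 'I_t -> M) : seq M :=
  [seq s <- codom g ++ codom (fun j => - g j) | s != 0].

Definition Cay (M : zmodType) (S : seq M) : rel M :=
  fun a b => has (fun s => (b == a + s) || (a == b + s)) S.

(* For r the adjacency relation of a graph; it holds for no n when x and y are
   not connected. *)
Definition is_dist (V : eqType) (r : rel V) (x y : V) (n : nat) : Prop :=
  (exists p, [/\ path r x p, last x p = y & size p = n]) /\
  (forall p, path r x p -> last x p = y -> (n <= size p)%N).

Definition isometric_at (U V : eqType) (r : rel U) (r' : rel V) (phi : U -> V)
    (u v : U) : Prop :=
  exists n, is_dist r u v n /\ is_dist r' (phi u) (phi v) n.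

Definition shortcut (U V : eqType) (r : rel U) (r' : rel V) (phi : U -> V)
    (u v : U) : Prop :=
  exists m n, [/\ is_dist r u v n, is_dist r' (phi u) (phi v) m & (m < n)%N].

(* Main.v *)
(* The sum of an assignment along a cycle is linear in the flow of that cycle,
   so consistency need only be tested on a cycle basis; there the row of A is the
   sum of the standard basis vectors, hence an assignment is consistent exactly
   when the homomorphism it defines on Z^t kills the row lattice of A.
   Unimodular changes of basis turn A into its Smith form and the quotient into
   a product of cyclic groups. By consistency sums along closed walks vanish, so
   the induced labeling changes by +g_j or -g_j along an edge of class j, and
   walks map to walks. *)

Require Import Defs.
From HB Require Import structures.
From mathcomp Require Import all_boot all_order all_algebra.
From mathcomp Require Import boolp zify.

Set Implicit Arguments.
Unset Strict Implicit.
Unset Printing Implicit Defensive.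

Import GRing.Theory.
Local Open Scope ring_scope.

(** * Homomorphisms out of a quotient group *)

Lemma quot_lift (R M : zmodType) (I : zmodClosed R) (F : {additive R -> M}) :
    (forall x, x \in I -> F x = 0) ->
  exists f : {additive Quotient.quot I -> M},
    forall x, f (\pi_(Quotient.quot I) x)%qT = F x.
Proof.
move=> F0; pose f (q : Quotient.quot I) := F (repr q).
have fpi x : f (\pi_(Quotient.quot I) x)%qT = F x.
  apply/eqP; rewrite -subr_eq0 -raddfB F0 //.
  by rewrite (Quotient.idealrBE I) reprK.
have fB : zmod_morphism f.
  move=> p q; rewrite -[p]reprK -[q]reprK -raddfB !fpi.
  exact: raddfB.
by exists (HB.pack_for {additive Quotient.quot I -> M} f
  (GRing.isZmodMorphism.Build _ _ f fB)).
Qed.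

(** Injectivity comes from the kernel being exactly [I], surjectivity from [h]. As [h] need not be
    additive, it may be built from arbitrary representatives. *)
Lemma quot_lift_bij (R M : zmodType) (I : zmodClosed R) (F : {additive R -> M})
    (h : M -> R) :
    (forall x, (x \in I) = (F x == 0)) -> cancel h F ->
  exists2 f : {additive Quotient.quot I -> M}, bijective f
    & forall x, f (\pi_(Quotient.quot I) x)%qT = F x.
Proof.
move=> FI hK; have F0 x : x \in I -> F x = 0 by rewrite FI => /eqP.
have [f fE] := quot_lift F0.
exists f => //; exists (fun m => (\pi_(Quotient.quot I) (h m))%qT).
- move=> q; rewrite -[q]reprK fE; apply/eqP.
  by rewrite -(Quotient.idealrBE I) FI raddfB /= hK subrr.
- by move=> m; rewrite fE hK.
Qed.

(** * Sums along walks and cycles *)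

Section Walks.
Variables (T : finType) (G : cgraph T) (t : nat) (P : oriented_partition G t).

Section Assignment.
Variables (M : zmodType) (g : 'I_t -> M).
Implicit Types (x y z : T) (p q c : seq T).

Lemma step_edge x y : adj G x y ->
  exists2 j, [set x; y] \in part P j
    & step P g x y = (if fwd P x y then g j else - g j).
Proof.
move=> xy; have /and3P[/eqP covP trivP _] := part_partition P.
have: [set x; y] \in cover [set part P j | j : 'I_t].
  by rewrite covP; apply/imsetP; exists (x, y); rewrite ?inE.
case/bigcupP=> _ /imsetP[j _ ->] xyj; exists j => //.
rewrite /step (big_pred1 j) // => k; apply/idP/eqP=> [xyk|-> //].
apply: (part_inj (o := P)); apply/eqP; apply: contraTT xyk => neq_kj.
apply: contraL xyj => xyk.
have := trivIsetP trivP _ _ (imset_f _ _) (imset_f _ _) neq_kj.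
by move/(_ isT isT)/pred0P/(_ [set x; y]) => /=; rewrite xyk /= => ->.
Qed.

Lemma step_sym x y : adj G x y -> step P g y x = - step P g x y.
Proof.
move=> xy; rewrite /step -sumrN setUC; apply: eq_bigr => j _.
by rewrite (fwd_orient P xy); case: (fwd P x y); rewrite /= ?opprK.
Qed.

Lemma path_sum_cat x p q :
  path_sum P g x (p ++ q) = path_sum P g x p + path_sum P g (last x p) q.
Proof. by elim: p x => [|y p IH] x /=; rewrite ?add0r // IH addrA. Qed.

(** [rev (belast x p)] is the walk backwards, with its new starting point [last x p] left out as in
    [path]. *)
Lemma path_sum_rev x p : path (adj G) x p ->
  path_sum P g (last x p) (rev (belast x p)) = - path_sum P g x p.
Proof.
elim: p x => [|y p IH] x /= => [_|/andP[xy yp]]; first by rewrite oppr0.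
rewrite rev_cons -cats1 path_sum_cat IH //= addr0 opprD addrC.
congr (_ + _); suff -> : last (last y p) (rev (belast y p)) = y.
  exact: step_sym.
by case: p {IH yp} => //= z p; rewrite rev_cons last_rcons.
Qed.

Lemma path_sumE x p : path_sum P g x p =
  \sum_(i < size p) step P g (nth x (x :: p) i) (nth x p i).
Proof.
elim: p x => [|y p IH] x /=; first by rewrite big_ord0.
rewrite big_ord_recl /= IH; congr (_ + _); apply: eq_bigr => i _.
congr (step _ _ _ _); apply: set_nth_default => //.
by rewrite /= ltnW // ltnS.
Qed.

Lemma cycle_sum_path x p : uniq (rcons p x) ->
  cycle_sum P g (rcons p x) = path_sum P g x (rcons p x).
Proof.
move=> Up; have Uxp : uniq (x :: p) by rewrite /= -rcons_uniq.
(* Rotating [x] to the front makes successors on the cycle agree with successive entries of the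
   walk. *)
have -> : cycle_sum P g (rcons p x) = cycle_sum P g (x :: p).
  rewrite /cycle_sum -rot1_cons (perm_big (x :: p)) /=; last first.
    by rewrite perm_rot.
  by apply: eq_bigr => y _; rewrite next_rot.
rewrite path_sumE size_rcons /cycle_sum (big_nth x) big_mkord.
apply: eq_bigr => i _; have lt_ip := ltn_ord i.
rewrite -[x :: rcons p x]/(rcons (x :: p) x) nth_rcons lt_ip.
congr (step _ _ _ _); rewrite next_nth mem_nth // index_uniq // nth_rcons.
(* At [i = size p] the cycle wraps around: [nth] falls back on its default [x], the last entry of
   [rcons p x]. *)
case: ltngtP => // [|->]; last by rewrite nth_default.
by rewrite ltnNge -ltnS lt_ip.
Qed.

End Assignment.

Lemma step_raddf (M N : zmodType) (f : {additive M -> N}) (g : 'I_t -> M) x y :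
  step P (fun j => f (g j)) x y = f (step P g x y).
Proof.
by rewrite /step raddf_sum; apply: eq_bigr => j _; case: ifP; rewrite ?raddfN.
Qed.

Lemma cycle_sum_raddf (M N : zmodType) (f : {additive M -> N}) (g : 'I_t -> M) c :
  cycle_sum P (fun j => f (g j)) c = f (cycle_sum P g c).
Proof. by rewrite /cycle_sum raddf_sum; apply: eq_bigr => x _; apply: step_raddf. Qed.

End Walks.

(** * Closed walks, the induced labeling and flows of cycles *)

Lemma not_uniq_split (T : eqType) (s : seq T) : ~~ uniq s ->
  exists p1 y p2 p3, s = p1 ++ y :: p2 ++ y :: p3.
Proof.
elim: s => //= x s IH; rewrite negb_and negbK; case/orP=> [xs|/IH].
  by case/splitPr: xs => p2 p3; exists [::], x, p2, p3.
by case=> p1 [y] [p2] [p3] ->; exists (x :: p1), y, p2, p3.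
Qed.

(* A closed walk either is a cycle, or goes back and forth along an edge, or
   splits at a repeated vertex into two shorter closed walks. *)
Lemma closed_walk_sum (T : finType) (G : cgraph T) (t : nat)
    (P : oriented_partition G t) (M : zmodType) (g : 'I_t -> M) x p :
  consistent P g -> path (adj G) x p -> last x p = x -> path_sum P g x p = 0.
Proof.
move=> gP; have [n] := ubnP (size p); elim: n x p => // n IH x p.
(* The base point [x] occurs in [p] as its last entry, so [uniq p] also excludes an early return to
   [x]. *)
rewrite ltnS => le_pn xp px; have [Up|/not_uniq_split] := boolP (uniq p).
  case/lastP: p => [//|p y] in le_pn xp px Up *.
  rewrite last_rcons in px; subst y.
  case: p => [|y [|z p]] in le_pn xp Up *.
  - by move: xp; rewrite /= adj_irr.
  - by move: xp => /= /andP[xy _]; rewrite (step_sym P g xy) addr0 subrr.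
  rewrite -cycle_sum_path //; apply: gP; split; last by rewrite size_rcons.
  by rewrite /ucycle Up -rot1_cons rot_cycle andbT.
case=> p1 [y] [p2] [p3] Ep; subst p.
have sp : (size (p2 ++ [:: y]) < n)%N /\ (size (p1 ++ y :: p3) < n)%N.
  by move: le_pn; rewrite !size_cat /= size_cat /=; lia.
move: xp px; rewrite cat_path /= cat_path /= last_cat /= last_cat /=.
case/and5P=> xp1 p1y yp2 p2y yp3 px.
have yp : path_sum P g y (p2 ++ [:: y]) = 0.
  by apply: IH; rewrite ?sp.1 ?cat_path ?last_cat /= ?yp2 ?p2y.
have: path_sum P g x (p1 ++ y :: p3) = 0.
  by apply: IH; rewrite ?sp.2 ?cat_path ?last_cat /= ?xp1 ?p1y.
move: yp; rewrite !path_sum_cat /= path_sum_cat /= addr0 => yp.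
by rewrite [path_sum P g y p2 + _]addrA yp add0r.
Qed.

(** The chosen path to [x], the edge [xy] and the reversed path to [y] form a closed walk at [r],
    whose sum vanishes. *)
Lemma labeling_step (T : finType) (G : cgraph T) (t : nat)
    (P : oriented_partition G t) (M : zmodType) (g : 'I_t -> M)
    (r : T) (phi : T -> M) x y :
  consistent P g -> induced_labeling P g r phi -> adj G x y ->
  phi y = phi x + step P g x y.
Proof.
move=> gP phiP xy.
have [p [/andP[rp _] px ->]] := phiP x; have [q [/andP[rq _] qy ->]] := phiP y.
have qr : last (last r q) (rev (belast r q)) = r.
  by case: (q) => //= z s; rewrite rev_cons last_rcons.
have wr : path (adj G) r (p ++ y :: rev (belast r q)).
  rewrite cat_path rp px /= xy -qy rev_path.
  by rewrite (eq_path (e' := adj G)) // => a b; rewrite /= adj_sym.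
have := closed_walk_sum gP wr; rewrite last_cat /= -{1}qy => /(_ qr) /eqP.
rewrite path_sum_cat /= px -{2}qy path_sum_rev // addrA subr_eq0.
by move/eqP.
Qed.

(* Pairing the flow of a cycle with the forward steps recovers the signed sum
   along the cycle, so the sums along all cycles are determined by those along
   a cycle basis. *)
Lemma cycle_sum_flow (T : finType) (G : cgraph T) (t : nat)
    (P : oriented_partition G t) (M : zmodType) (g : 'I_t -> M) c :
  cycle (adj G) c -> uniq c ->
  cycle_sum P g c =
  \sum_(u | adj G u.1 u.2 && fwd P u.1 u.2) step P g u.1 u.2 *~ cycle_flow c u.
Proof.
move=> Gc Uc; under [RHS]eq_bigr do rewrite ffunE mulrz_sumr.
rewrite exchange_big /cycle_sum big_seq [RHS]big_seq; apply: eq_bigr => x xc /=.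
have xnx : adj G x (next c x) by apply: next_cycle.
have pick (D : pred (T * T)) a (F : T * T -> M) :
  \sum_(u | D u) F u *~ (a == u)%:R = if D a then F a else 0.
  case: ifP => Da.
    rewrite (bigD1 a) //= eqxx big1 ?addr0 // => u /andP[_].
    by rewrite eq_sym => /negPf->.
  by rewrite big1 // => u Du; case: eqP => // au; rewrite au Du in Da.
(* Exactly one of the step and its reverse is forward; a backward step is counted through its
   reverse with coefficient -1, which [step_sym] turns into the right sign. *)
under eq_bigr do rewrite mulrzBr; rewrite sumrB !pick /=.
rewrite (adj_sym G (next c x)) xnx (fwd_orient P xnx) /=.
by case: (fwd P x _); rewrite /= ?subr0 // (step_sym P g xnx) sub0r opprK.
Qed.

(** * Cycle bases and the universal property *)

Section Basis.
Variables (T : finType) (G : cgraph T) (t : nat) (P : oriented_partition G t).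
Variables (c : nat) (B : 'I_c -> seq T).
Hypothesis hB : is_cycle_basis G B.
Let A := cycle_class_matrix P B.

(** Since the coefficients are integers, the relation between flows can be evaluated in any abelian
    group, torsion included. *)
Lemma cycle_sum_basis (M : zmodType) (g : 'I_t -> M) z : is_cycle G z ->
  exists k : 'I_c -> int, cycle_sum P g z = \sum_i cycle_sum P g (B i) *~ k i.
Proof.
have [cB _ spanB] := hB; move=> cz; have [k zE] := spanB z cz; exists k.
have [/andP[Gz Uz] _] := cz; rewrite cycle_sum_flow // zE.
under [RHS]eq_bigr => i _.
  have [/andP[Gi Ui] _] := cB i; rewrite cycle_sum_flow // mulrz_suml.
  over.
rewrite exchange_big; apply: eq_bigr => u _; rewrite sum_ffunE mulrz_sumr.
apply: eq_bigr => i _; rewrite -mulrzA; congr (_ *~ _).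
have ffunMz (f : {ffun T * T -> int}) n : (f *~ n) u = f u *~ n.
  by case: n => n; rewrite ?NegzE ?mulrNz ?ffunE -!pmulrn ?ffunMnE.
by rewrite ffunMz mulrzz.
Qed.

(** Seeing a row as a cycle sum in the free group lets homomorphisms be applied to it, both the
    projection to the quotient and the linear extension of an assignment. *)
Lemma row_cycle_class i : row i A = cycle_sum P (delta_mx 0) (B i).
Proof.
apply/rowP=> j; rewrite !mxE /cycle_sum summxE big_mkcond /=.
apply: eq_bigr => x _; rewrite /step summxE.
rewrite [RHS]big_mkcond (bigD1 j) //= big1 ?addr0 => [|k neq_kj].
  by do 2!case: ifP => // _; rewrite !mxE !eqxx.
by do 2!case: ifP => // _; rewrite !mxE eqxx eq_sym (negPf neq_kj) ?oppr0.
Qed.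

(** On a basis cycle the sum is the class of a row of [A], hence zero; the basis then controls every
    cycle. *)
Lemma gen_univ_consistent : consistent P (gen_univ A).
Proof.
move=> z /(cycle_sum_basis (gen_univ A))[k ->].
rewrite big1 // => i _.
pose pi : {additive 'rV[int]_t -> Gamma_univ A} := \pi_(Quotient.quot (rowlattice A))%qT.
rewrite (cycle_sum_raddf P pi (delta_mx 0)) -row_cycle_class.
suff -> : pi (row i A) = 0 by rewrite mul0rz.
apply/eqP; rewrite -(raddf0 pi) -(Quotient.idealrBE (rowlattice A)) subr0.
by apply/asboolP; exists (delta_mx 0 i); rewrite rowE.
Qed.

(** The linear extension of [g] to the free group sends each row of [A] to the sum along a basis
    cycle, so it factors through the quotient. *)
Lemma gen_univ_universal (M : zmodType) (g : 'I_t -> M) : consistent P g ->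
  exists f : {additive Gamma_univ A -> M}, forall j, f (gen_univ A j) = g j.
Proof.
move=> gP; pose F (v : 'rV[int]_t) := \sum_j g j *~ v 0 j.
have FB : zmod_morphism F.
  by move=> u v; rewrite /F -sumrB; apply: eq_bigr => j _; rewrite !mxE mulrzBr.
pose Fa := HB.pack_for {additive 'rV[int]_t -> M} F
  (GRing.isZmodMorphism.Build _ _ F FB).
have Fdelta j : Fa (delta_mx 0 j) = g j.
  rewrite /= /F (bigD1 j) //= mxE !eqxx big1 ?addr0 // => k neq_kj.
  by rewrite mxE (negPf neq_kj) andbF.
have FA v : v \in rowlattice A -> Fa v = 0.
  case/asboolP=> u ->; rewrite mulmx_sum_row raddf_sum big1 // => i _.
  rewrite -[u 0 i]intz scaler_int raddfMz row_cycle_class -cycle_sum_raddf.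
  have -> : cycle_sum P (fun j => Fa (delta_mx 0 j)) (B i) = cycle_sum P g (B i).
    by congr (cycle_sum P _ _); apply/funext.
  by have [cB _ _] := hB; rewrite gP ?mul0rz.
have [f fE] := quot_lift FA; exists f => j; by rewrite fE Fdelta.
Qed.

End Basis.

Lemma Gamma_univ_fg c t (A : 'M[int]_(c, t)) : finitely_generated (Gamma_univ A).
Proof.
exists t, (gen_univ A) => x.
pose pi : {additive 'rV[int]_t -> Gamma_univ A} := \pi_(Quotient.quot (rowlattice A))%qT.
exists (fun j => repr x 0 j); rewrite -[LHS]reprK -[LHS]/(pi (repr x)).
rewrite [X in pi X]row_sum_delta raddf_sum; apply: eq_bigr => j _.
by rewrite -[X in X *: _]intz scaler_int raddfMz.
Qed.

(** * Smith normal form of the universal group *)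

Lemma to_Zmod_eq0 d k : (to_Zmod d k == 0) = (d %| k)%Z.
Proof.
rewrite -(raddf0 (\pi_(Quotient.quot (dvdz d : {pred int})))%qT).
by rewrite -(Quotient.idealrBE (dvdz d : {pred int})) subr0.
Qed.

(* Since U A^T W = D, the automorphism v |-> v U^T of Z^t carries the row
   lattice of A onto that of D^T, and Z^t / rowlattice (D^T) is the product. *)
Lemma Gamma_univ_smith c t (A : 'M[int]_(c, t)) (U : 'M[int]_t) (W : 'M[int]_c)
    (d : seq int) (n : nat) :
  U \in unitmx -> W \in unitmx -> size d = n -> (n <= c)%N -> (n <= t)%N ->
  U *m A^T *m W = diag_of_seq t c d ->
  exists2 f : {additive Gamma_univ A -> (Zmod_prod d * 'rV[int]_(t - n))%type},
    bijective f
    & forall i j : 'I_t,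
      (forall k : 'I_(size d), i = k :> nat ->
         (f (gen_univ A j)).1 k = to_Zmod d`_k (U i j)) /\
      (forall k : 'I_(t - n), i = (n + k)%N :> nat ->
         (f (gen_univ A j)).2 0 k = U i j).
Proof.
move=> Uu Wu dn; subst n => le_dc le_dt UAW.
have UTu : U^T \in unitmx by rewrite unitmx_tr.
pose e1 (k : 'I_(size d)) : 'I_t := cast_ord (subnKC le_dt) (lshift (t - size d) k).
pose e2 (k : 'I_(t - size d)) : 'I_t := cast_ord (subnKC le_dt) (rshift (size d) k).
have eP (Q : 'I_t -> Prop) : (forall k, Q (e1 k)) -> (forall k, Q (e2 k)) ->
    forall i, Q i.
  move=> Q1 Q2 i; rewrite -[i](cast_ordKV (subnKC le_dt)).
  by case: (split_ordP (cast_ord (esym (subnKC le_dt)) i)) => k ->; [apply: Q1 | apply: Q2].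
(* On the basis vector [j] the product with [U^T] is column [j] of [U]; the first [size d]
   coordinates are the torsion ones. *)
pose F (v : 'rV[int]_t) : (Zmod_prod d * 'rV[int]_(t - size d))%type :=
  ([ffun k : 'I_(size d) => to_Zmod d`_k ((v *m U^T) 0 (e1 k))],
   \row_k (v *m U^T) 0 (e2 k)).
have FB : zmod_morphism F.
  move=> u v; rewrite /F mulmxBl; congr (_, _).
    by apply/ffunP=> k; rewrite !ffunE !mxE /to_Zmod raddfB.
  by apply/rowP=> k; rewrite !mxE.
pose Fa := HB.pack_for
  {additive 'rV[int]_t -> (Zmod_prod d * 'rV[int]_(t - size d))%type} F
  (GRing.isZmodMorphism.Build _ _ F FB).
have DT : A *m U^T = invmx W^T *m (diag_of_seq t c d)^T.
  rewrite -UAW !trmx_mul trmxK mulKmx //; last by rewrite unitmx_tr.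
have DTE (w : 'rV[int]_c) i : (w *m (diag_of_seq t c d)^T) 0 i =
    \sum_(k < c) w 0 k * (d`_i *+ (i == k :> nat)).
  by rewrite !mxE; apply: eq_bigr => k _; rewrite !mxE.
have latticeE v : (v \in rowlattice A) = (Fa v == 0).
  apply/asboolP/eqP=> [[u ->]|].
    rewrite /Fa /= /F -mulmxA DT mulmxA; congr (_, _).
      apply/ffunP=> k; rewrite !ffunE DTE; apply/eqP; rewrite to_Zmod_eq0.
      apply: rpred_sum => j _; apply/dvdz_mull.
      by rewrite -mulr_natr dvdz_mulr.
    apply/rowP=> k; rewrite mxE DTE mxE big1 // => j _.
    (* Free coordinates lie past the end of [d], where the default entry is 0. *)
    by rewrite nth_default ?mul0rn ?mulr0 // leq_addr.
  case=> /ffunP F1 /rowP F2.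
  (* [y] extends the coordinates of [v *m U^T] by zero, as [w] has length [c] and not [t]. Vanishing
     torsion coordinates make the divisions in [w] exact below [size d]. *)
  pose y (m : nat) := if insub m is Some i then (v *m U^T) 0 i else 0.
  pose w : 'rV[int]_c := \row_k (y k %/ d`_k)%Z.
  exists (w *m W^T); apply: (can_inj (mulmxK UTu)).
  rewrite /= -!mulmxA DT mulKVmx ?unitmx_tr //; apply/rowP.
  have wE k : w 0 k = (y k %/ d`_k)%Z by rewrite mxE.
  apply: eP => k; rewrite DTE.
    have yk : y k = (v *m U^T) 0 (e1 k).
      by rewrite /y (_ : insub (k : nat) = Some (e1 k)) //; apply: (valK (e1 k)).
    rewrite (bigD1 (widen_ord le_dc k)) //= eqxx mulr1n big1 ?addr0 => [|j neq_jk].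
      rewrite wE yk divzK // -to_Zmod_eq0.
      by have /eqP := F1 k; rewrite !ffunE.
    by rewrite eq_sym (inj_eq val_inj j (widen_ord le_dc k)) (negPf neq_jk) mulr0.
  rewrite big1 => [|j _]; first by have := F2 k; rewrite mxE [RHS]mxE.
  by rewrite nth_default ?mul0rn ?mulr0 // leq_addr.
pose h (ab : (Zmod_prod d * 'rV[int]_(t - size d))%type) : 'rV[int]_t :=
  castmx (erefl, subnKC le_dt) (row_mx (\row_k repr (ab.1 k)) ab.2) *m invmx U^T.
have hK : cancel h Fa.
  case=> a b; rewrite /Fa /= /F mulmxKV //; congr (_, _).
    apply/ffunP=> k; rewrite ffunE castmxE cast_ordK row_mxEl mxE.
    by rewrite /to_Zmod reprK.
  by apply/rowP=> k; rewrite mxE castmxE cast_ordK row_mxEr ord1.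
have [f f_bij fE] := quot_lift_bij latticeE hK; exists f => // i j.
have UE l : ((delta_mx 0 j : 'rV[int]_t) *m U^T) 0 l = U l j by rewrite -rowE !mxE.
split=> k ik; rewrite fE /= /F /=.
  by rewrite ffunE UE; congr (to_Zmod _ (U _ _)); apply: val_inj.
by rewrite mxE UE; congr (U _ _); apply: val_inj.
Qed.

(** * Distances *)

(** The vertex type may be infinite, as in a Cayley graph, so the distance is obtained as the least
    length of a walk. *)
Lemma walk_dist (V : eqType) (r : rel V) x p :
  path r x p -> exists2 n, is_dist r x (last x p) n & (n <= size p)%N.
Proof.
move=> xp; pose Q n := `[< exists q, [/\ path r x q, last x q = last x p & size q = n] >].
have exQ : exists n, Q n by exists (size p); apply/asboolP; exists p.
have [n /asboolP Qn minQ] := ex_minnP exQ.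
exists n; last by apply: minQ; apply/asboolP; exists p.
by split=> // q xq qp; apply: minQ; apply/asboolP; exists q.
Qed.

(** An edge whose generator is 0 is collapsed by the labeling; dropping such stationary steps leaves
    a genuine walk that is no longer. *)
Lemma path_remove_stutter (V : eqType) (r : rel V) x p :
  path (fun a b => (a == b) || r a b) x p ->
  exists q, [/\ path r x q, last x q = last x p & (size q <= size p)%N].
Proof.
elim: p x => [|y p IH] x /=; first by exists [::].
case/andP=> xy /IH[q [yq <- le_qp]].
case/orP: xy => [/eqP->|xy]; first by exists q; rewrite ltnW.
by exists (y :: q); rewrite /= xy.
Qed.

(** * The labeling as a map into the Cayley graph *)

Section Labeling.
Variables (T : finType) (G : cgraph T) (t : nat) (P : oriented_partition G t).
Variables (M : zmodType) (g : 'I_t -> M) (r : T) (phi : T -> M).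
Hypotheses (gP : consistent P g) (phiP : induced_labeling P g r phi).
Let S := signed_gens g.

Lemma labeling_edge x y : adj G x y ->
  exists2 j, [set x; y] \in part P j
    & if g j == 0 then phi x == phi y else Cay S (phi x) (phi y).
Proof.
move=> xy; have [j xyj stepE] := step_edge P g xy; exists j => //.
rewrite (labeling_step gP phiP xy) stepE; case: eqP => [->|/eqP gj].
  by rewrite oppr0 if_same addr0.
apply/hasP; exists (if fwd P x y then g j else - g j); last by rewrite eqxx.
rewrite mem_filter mem_cat; case: ifP => _; rewrite ?oppr_eq0 gj /=.
  by rewrite codom_f.
by rewrite (codom_f (fun j => - g j)) orbT.
Qed.

Lemma labeling_path x p : path (adj G) x p ->
  path (fun a b => (a == b) || Cay S a b) (phi x) (map phi p).
Proof.
rewrite path_map; apply: sub_path => y z /= yz.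
by have [j _] := labeling_edge yz; case: ifP => _ ->; rewrite ?orbT.
Qed.

Lemma labeling_path_nondegenerate x p : path (adj G) x p ->
  (forall y z j, infix [:: y; z] (x :: p) -> [set y; z] \in part P j -> g j != 0) ->
  path (Cay S) (phi x) (map phi p).
Proof.
elim: p x => //= y p IH x /andP[xy yp] gn0; apply/andP; split.
  have [j xyj] := labeling_edge xy; rewrite (negPf (gn0 x y j _ xyj)) //.
  by rewrite /= !eqxx prefix0s.
apply: IH => // a b j ab; apply: gn0.
by rewrite ab orbT.
Qed.

(** The image of a shortest walk, with stationary steps dropped, both shows that the Cayley distance
    exists and bounds it. *)
Lemma labeling_dist u v : exists m n,
  [/\ is_dist (Cay S) (phi u) (phi v) m, is_dist (adj G) u v n & (m <= n)%N].
Proof.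
have /connectP[p0 up0 ->] := adj_connected G u v.
have [n uvn _] := walk_dist up0; have [[p [up pv sp]] _] := uvn.
have [q [uq qv le_qp]] := path_remove_stutter (labeling_path up).
have [m qm le_mq] := walk_dist uq; exists m, n; split=> //.
  by move: qm; rewrite qv last_map pv.
by rewrite -sp (leq_trans le_mq) // (leq_trans le_qp) // size_map.
Qed.

End Labeling.
Theorem theorem3p12 (T : finType) (G : cgraph T) (t : nat)
    (P : oriented_partition G t) (c : nat) (B : 'I_c -> seq T)
    (hB : is_cycle_basis G B) :
  let A := cycle_class_matrix P B in
  let Gamma := Gamma_univ A in
  let g : 'I_t -> Gamma := gen_univ A in
  let rho := int_rank A in
  [/\ (* (i) *)
      [/\ finitely_generated Gamma,
          consistent P g
        & forall (M : zmodType) (g' : 'I_t -> M), consistent P g' ->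
            exists f : {additive Gamma -> M}, forall j, f (g j) = g' j],
      (* (ii) *)
      forall (U : 'M[int]_t) (W : 'M[int]_c) (d : seq int),
        U \in unitmx -> W \in unitmx -> size d = rho ->
        U *m A^T *m W = diag_of_seq t c d ->
        exists f : {additive Gamma -> (Zmod_prod d * 'rV[int]_(t - rho))%type},
          bijective f /\
          forall i j : 'I_t,
            (forall k : 'I_(size d), i = k :> nat ->
               (f (g j)).1 k = to_Zmod d`_k (U i j)) /\
            (forall k : 'I_(t - rho), i = (rho + k)%N :> nat ->
               (f (g j)).2 0 k = U i j)
    & (* (iii) *)
      forall (r : T) (phi : T -> Gamma), induced_labeling P g r phi ->
        let S := signed_gens g in
        [/\ forall (x : T) (p : seq T), is_path G x p ->
              path (fun a b => (a == b) || Cay S a b) (phi x) (map phi p),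
            forall (x : T) (p : seq T), is_path G x p ->
              (forall (y z : T) (j : 'I_t), infix [:: y; z] (x :: p) ->
                 [set y; z] \in part P j -> g j != 0) ->
              path (Cay S) (phi x) (map phi p),
            forall u v : T, exists m n : nat,
              [/\ is_dist (Cay S) (phi u) (phi v) m,
                  is_dist (adj G) u v n & (m <= n)%N]
          & forall u v : T, ~ isometric_at (adj G) (Cay S) phi u v ->
              shortcut (adj G) (Cay S) phi u v]].
Proof.
split; first by split; [exact: Gamma_univ_fg | exact: gen_univ_consistent
                       | exact: gen_univ_universal].
  move=> U W d Uu Wu dn UAW.
  have [f f_bij fE] := Gamma_univ_smith Uu Wu dn (rank_leq_row _) (rank_leq_col _) UAW.
  by exists f.
move=> r phi phiP; have gP := gen_univ_consistent P hB.
split.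
- by move=> x p /andP[xp _]; apply: (labeling_path gP phiP xp).
- by move=> x p /andP[xp _]; apply: (labeling_path_nondegenerate gP phiP xp).
- exact: (labeling_dist gP phiP).
(* Both distances exist with [m <= n], and equality would be isometry at the pair. *)
move=> u v not_iso; have [m [n [dm dn le_mn]]] := labeling_dist gP phiP u v.
exists m, n; split=> //; rewrite ltn_neqAle le_mn andbT.
by apply: contra_notN not_iso => /eqP mn; exists n; rewrite -{2}mn.
Qed.
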